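(* Let $\psi$ be a CGF-like function on an open interval $\Lambda\ni0$ and suppose arm $k\in[k^*]$ is sub-$\psi$. Consider an arbitrary (adaptive) sampling algorithm and stopping time $\mathcal{T}$. If there exist a deterministic time $t_0$ and $b>0$ such that $\mathcal{T}\ge t_0$ and $N_k(t_0)\ge b$ almost surely, then $$\mathbb{E}\big[D_{\psi_{\mu_k}^*}(\hat\mu_k(\mathcal{T}),\mu_k)\big]\le\min\Big\{2e\,\frac{1+\log(n_k^{\mathrm{eff}}/b)}{n_k^{\mathrm{eff}}},\ \inf_{r>1}\frac{C_r}{n_k^{\mathrm{eff},r}}\Big\},$$ where for $r>1$, $C_r:=\inf_{q\in(1,r)}\frac{2^{q/r}}{e}\frac{r^2}{(r-q)(q-1)}$. In particular, $C_r\to\infty$ as $r\to1$.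
   Context: Multi-armed bandit model: arms $P_1,\dots,P_{k^*}$ on $\mathbb{R}$ with finite means $\mu_k$. $W$ is an independent external random variable; at each time $t$, given $\mathcal{D}_{t-1}=\{W,A_1,Y_1,\dots,A_{t-1},Y_{t-1}\}$, an arm $A_t\in[k^*]$ is drawn with conditional probabilities $\nu_t(\cdot\mid\mathcal{D}_{t-1})$ and $Y_t$ is an independent draw from $P_{A_t}$. Filtration: $\mathcal{F}_0=\sigma(W,A_1)$, $\mathcal{F}_t=\sigma(W,A_1,Y_1,\dots,A_t,Y_t,A_{t+1})$; $\mathcal{T}$ is an (a.s. finite) stopping time w.r.t. $(\mathcal{F}_t)$. $N_k(t)=\sum_{s\le t}\mathbf{1}(A_s=k)$, $S_k(t)=\sum_{s\le t}\mathbf{1}(A_s=k)Y_s$, $\hat\mu_k(t)=S_k(t)/N_k(t)$. Effective sample sizes: $n_k^{\mathrm{eff}}=[\mathbb{E}(1/N_k(\mathcal{T}))]^{-1}$ and, for $r>1$, $n_k^{\mathrm{eff},r}=[\mathbb{E}(1/N_k^r(\mathcal{T}))]^{-1/r}$. A function $\psi:\Lambda=(\lambda_{\min},\lambda_{\max})\to[0,\infty)$ with $\lambda_{\min}<0<\lambda_{\max}$ is CGF-like if it is nonnegative, twice continuously differentiable, strictly convex, with $\psi(0)=\psi'(0)=0$. A distribution $P$ with mean $\mu$ is sub-$\psi$ if $\log\mathbb{E}_{Y\sim P}e^{\lambda(Y-\mu)}\le\psi(\lambda)$ for all $\lambda\in\Lambda$. Set $\psi_\mu(\lambda)=\lambda\mu+\psi(\lambda)$,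 $\psi_\mu^*(z)=\sup_{\lambda\in\Lambda}\{\lambda z-\psi_\mu(\lambda)\}$, and Bregman divergence $D_{\psi_\mu^*}(\hat\mu,\mu)=\psi_\mu^*(\hat\mu)-\psi_\mu^*(\mu)-\psi_\mu^{*\prime}(\mu)(\hat\mu-\mu)$. *)

(* Defs.v *)
From HB Require Import structures.
From mathcomp Require Import all_boot all_order all_algebra.
From mathcomp Require Import all_classical all_reals all_analysis.
Set Implicit Arguments. Unset Strict Implicit. Unset Printing Implicit Defensive.
Import Order.TTheory GRing.Theory Num.Theory.
Import numFieldNormedType.Exports.
Local Open Scope classical_set_scope.
Local Open Scope ring_scope.

(* Bandit model.  Times are 1-based: A t, Y t are the arm and reward at time
   t >= 1 (the values at t = 0 are unused).  Arms are 'I_K. *)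

Section Bandit.
Context {R : realType} {d dW : measure_display} {Omega : measurableType d}
  {TW : measurableType dW} {K : nat}.
Variables (W : Omega -> TW) (A : nat -> Omega -> 'I_K) (Y : nat -> Omega -> R).

Definition hist_gen (t : nat) : set (set Omega) :=
  [set E | (exists B, measurable B /\ E = W @^-1` B)
        \/ (exists s a, (1 <= s <= t.+1)%N /\ E = [set w | A s w = a])
        \/ (exists s B, (1 <= s <= t)%N /\ measurable B /\ E = Y s @^-1` B)].

Definition filt (t : nat) : set (set Omega) := <<s hist_gen t >>.

Definition Ncount (k : 'I_K) (t : nat) (w : Omega) : nat :=
  (\sum_(1 <= s < t.+1) (A s w == k))%N.
Definition Ssum (k : 'I_K) (t : nat) (w : Omega) : R :=
  \sum_(1 <= s < t.+1) (if A s w == k then Y s w else 0).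
Definition muhat (k : 'I_K) (t : nat) (w : Omega) : R :=
  Ssum k t w / (Ncount k t w)%:R.

(* evaluation at an (a.s. finite) random time T; value on {T = None}
   is irrelevant (a null event) *)
Definition at_time {V} (v0 : V) (X : nat -> Omega -> V) (T : Omega -> option nat)
  (w : Omega) : V := if T w is Some t then X t w else v0.
End Bandit.

(* Model hypothesis: at each time t >= 1, given D_{t-1} and A_t
   (i.e. given F_{t-1} = sigma(W, A_1, Y_1, ..., Y_{t-1}, A_t)),
   Y_t is an independent draw from P_{A_t}. *)
Definition bandit_model {R : realType} {d dW : measure_display}
  {Omega : measurableType d} {TW : measurableType dW} {K : nat}
  (P : probability Omega R) (Pk : 'I_K -> probability R R)
  (W : Omega -> TW) (A : nat -> Omega -> 'I_K) (Y : nat -> Omega -> R) : Prop :=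
  [/\ measurable_fun setT W,
      (forall t a, measurable [set w | A t w = a]),
      (forall t, measurable_fun setT (Y t)) &
      (forall t, (1 <= t)%N -> forall E, filt W A Y t.-1 E ->
        forall (a : 'I_K) (B : set R), measurable B ->
        P (E `&` [set w | A t w = a] `&` Y t @^-1` B)
        = (P (E `&` [set w | A t w = a]) * Pk a B)%E)].

Definition as_finite_stopping_time {R : realType} {d dW : measure_display}
  {Omega : measurableType d} {TW : measurableType dW} {K : nat}
  (P : probability Omega R)
  (W : Omega -> TW) (A : nat -> Omega -> 'I_K) (Y : nat -> Omega -> R)
  (T : Omega -> option nat) : Prop :=
  (forall t, filt W A Y t [set w | T w = Some t]) /\
  P [set w | T w = None] = 0%E.

Definition CGF_like {R : realType} (psi : R -> R) (lmin lmax : \bar R) : Prop :=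
  let Lam := [set x : R | (lmin < x%:E < lmax)%E] in
  [/\ (lmin < 0%:E < lmax)%E,
      (forall x, Lam x -> 0 <= psi x),
      (forall x, Lam x -> derivable psi x 1 /\ derivable (derive1 psi) x 1
                         /\ {for x, continuous (derive1 (derive1 psi))}),
      (forall x y (l : R), Lam x -> Lam y -> x != y -> 0 < l < 1 ->
          psi (l * x + (1 - l) * y) < l * psi x + (1 - l) * psi y) &
      psi 0 = 0 /\ derive1 psi 0 = 0].

Definition mean {R : realType} (Q : probability R R) : R := fine (\int[Q]_x x%:E).

Definition sub_psi {R : realType} (psi : R -> R) (lmin lmax : \bar R)
  (Q : probability R R) : Prop :=
  Q.-integrable setT (fun x => x%:E) /\
  forall l : R, (lmin < l%:E < lmax)%E ->
    (\int[Q]_x (expR (l * (x - mean Q)))%:E <= (expR (psi l))%:E)%E.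

Definition psi_mu {R : realType} (psi : R -> R) (mu : R) (l : R) : R := l * mu + psi l.
Definition psi_star {R : realType} (psi : R -> R) (lmin lmax : \bar R) (mu z : R)
  : \bar R :=
  ereal_sup [set (l * z - psi_mu psi mu l)%:E | l in [set l : R | (lmin < l%:E < lmax)%E]].
Definition bregman {R : realType} (psi : R -> R) (lmin lmax : \bar R) (mu zhat : R)
  : \bar R :=
  (psi_star psi lmin lmax mu zhat - (fine (psi_star psi lmin lmax mu mu))%:E
   - ((derive1 (fun z => fine (psi_star psi lmin lmax mu z)) mu) * (zhat - mu))%:E)%E.

Definition Cr {R : realType} (r : R) : R :=
  inf [set (2 `^ (q / r) / expR 1 * (r ^+ 2 / ((r - q) * (q - 1)))) | q in `]1, r[%classic].

Definition n_eff {R : realType} {d : measure_display} {Omega : measurableType d}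
  (P : probability Omega R) (N : Omega -> nat) : R :=
  (fine (\int[P]_w ((N w)%:R^-1)%:E))^-1.
Definition n_eff_r {R : realType} {d : measure_display} {Omega : measurableType d}
  (P : probability Omega R) (N : Omega -> nat) (r : R) : R :=
  (fine (\int[P]_w ((((N w)%:R : R) `^ r)^-1)%:E)) `^ (- r^-1).

(* Main.v *)
(* Let [N = N_k(T)], [X = muhat_k(T) - mu_k] and [D = psi^*(X)], which is the
   Bregman divergence because [psi_mu^*] vanishes to first order at [mu].
   For every slope [l] the process [exp (l (S - mu N) - psi l * N)] is a
   supermartingale of initial value 1, so [E exp (N (l X - psi l)) <= 1].
   On each side of 0, one slope nearly witnesses [D > x] for all deviations
   beyond a threshold; hence [E (1_{D > x} exp (x N)) <= 2] for all [x >= 0].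
   Both bounds follow by integrating over [x] an estimate of [P (D > x)].
   - With [v = E (1/N)] and [k = v b], on [D > x] either [x < 2 ln (1/k) / N] or
     [1 <= k exp (x N / 2) <= k exp (- x b / 2) exp (x N)]; integrating gives
     [E D <= 2 v ln (1/k) + 4 k / b].
   - Weighted AM-GM between [exp (x N)] and [N^-r] gives [P (D > x) <= (c/x)^a]
     with [a = r/q > 1] and [c] proportional to [E (N^-r)^(1/r)], hence
     [E D <= c a / (a - 1)]. *)
Require Import Defs.
From HB Require Import structures.
From mathcomp Require Import all_boot all_order all_algebra.
From mathcomp Require Import ring lra.
From mathcomp Require Import all_classical all_reals all_analysis.
From mathcomp Require Import measurable_realfun.
Set Implicit Arguments. Unset Strict Implicit. Unset Printing Implicit Defensive.
Import Order.TTheory GRing.Theory Num.Theory.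
Import numFieldNormedType.Exports.
Local Open Scope classical_set_scope.
Local Open Scope ring_scope.

(** * From exponential tail estimates to expectations *)

Section RealIntegrals.
Context {R : realType}.
Local Notation leb := (@lebesgue_measure R).

Lemma integral_expRN (c : R) : 0 < c ->
  (\int[leb]_(x in `[0%R, +oo[) (expR (- c * x))%:E = (c^-1)%:E)%E.
Proof.
move=> c0.
have cc : continuous (fun x : R => expR (- c * x)).
  move=> x; apply: continuous_comp; last exact: continuous_expR.
  exact: mulrl_continuous.
have dF (x : R) : is_derive x 1 (fun x => - (c^-1 * expR (- c * x))) (expR (- c * x)).
  apply: is_derive_eq.
  by rewrite /GRing.scale/=; field; rewrite gt_eqF.
rewrite (@ge0_continuous_FTC2y _ _ (fun x => - (c^-1 * expR (- c * x))) _ 0)//.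
- by rewrite mulr0 expR0 mulr1 EFinN oppeK add0e.
- exact: continuous_subspaceT.
- suff : - (c^-1 * expR (- c * x)) @[x --> +oo] --> - (c^-1 * 0).
    by rewrite mulr0 oppr0.
  apply: cvgN; apply: cvgMr.
  rewrite (_ : (fun x => expR (- c * x)) =
               (fun z => expR (- z)) \o (fun z => c * z)); last first.
    by apply: eq_fun => x; rewrite mulNr.
  apply: (@cvg_comp _ _ _ _ _ _ (pinfty_nbhs R)); last exact: cvgr_expR.
  exact: gt0_cvgMry.
- apply: cvgN; apply: cvgMr; apply: cvg_at_right_filter; exact: cc.
- by move=> x _; rewrite derive1E derive_val.
Qed.

Lemma powR_tail_cvg (a c : R) : 0 < a -> c * x `^ (- a) @[x --> +oo] --> (0 : R).
Proof.
move=> a0; rewrite -[X in _ --> X](mulr0 c); apply: cvgMr.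
apply/cvgrPdist_lt => e e0; near=> x.
have x0 : 0 < x by near: x; exact: nbhs_pinfty_gt.
rewrite sub0r normrN ger0_norm ?powR_ge0// powRN.
rewrite invf_plt ?posrE ?powR_gt0//.
have -> : e^-1 = (e^-1 `^ a^-1) `^ a.
  by rewrite -powRrM mulVf ?gt_eqF// powRr1// invr_ge0 ltW.
apply: gt0_ltr_powR => //; rewrite ?nnegrE ?powR_ge0// ?ltW//.
Unshelve. all: by end_near.
Qed.

Lemma integral_powR_tail (c a : R) : 0 < c -> 1 < a ->
  (\int[leb]_(x in `[c, +oo[) (c `^ a * x `^ (- a))%:E = (c / (a - 1))%:E)%E.
Proof.
move=> c0 a1.
have dF (x : R) : 0 < x ->
    is_derive x 1 (fun x => - (c `^ a / (a - 1)) * x `^ (- (a - 1)))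
      (c `^ a * x `^ (- a)).
  move=> x0; have D := is_deriveZ (- (c `^ a / (a - 1))) (is_derive1_powR (- (a - 1)) x0).
  apply: (is_derive_eq D); rewrite /GRing.scale/= (_ : - (a - 1) - 1 = - a); last by ring.
  by field; rewrite subr_eq0 gt_eqF.
have cF (x : R) : 0 < x -> {for x, continuous (fun x => c `^ a * x `^ (- a))}.
  move=> x0; apply: differentiable_continuous; apply/derivable1_diffP.
  apply: derivableM => //; apply: derivable_powR.
  by rewrite in_itv/= x0.
rewrite (@ge0_continuous_FTC2y _ _
  (fun x => - (c `^ a / (a - 1)) * x `^ (- (a - 1))) _ 0)//.
- rewrite -EFinB mulNr opprK add0r mulrAC -powRD; last by rewrite (gt_eqF c0) implybT.
  by rewrite (_ : a + - (a - 1) = 1) ?powRr1 ?ltW//; ring.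
- by move=> x _; rewrite mulr_ge0// powR_ge0.
- apply/continuous_within_itvcyP; split.
    by move=> x; rewrite in_itv/= andbT => cx; apply: cF; exact: lt_trans cx.
  by apply: cvg_at_right_filter; exact: cF.
- by apply: powR_tail_cvg; rewrite subr_gt0.
- by move=> x cx; have [] := dF x (lt_trans c0 cx).
- have [/derivable1_diffP/differentiable_continuous cG _] := dF c c0.
  by apply: cvg_at_right_filter; exact: cG.
- move=> x; rewrite in_itv/= andbT => cx.
  by rewrite derive1E; have [_ ->] := dF x (lt_trans c0 cx).
Qed.

(* With [z = (1 - t) x u / a], the inequality is [(1 - t) e^X + t e^Y >= 1] for
   exponents satisfying [(1 - t) X + t Y = a (z - 1 - ln z) >= 0]. *)
Lemma weighted_young (t a r x u M c : R) :
  0 < t < 1 -> 0 < a -> a = r * t -> 0 < x -> 0 < u -> 0 < M ->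
  c = a / ((1 - t) * expR 1) * (2 `^ (1 - t) * M `^ t) `^ a^-1 ->
  1 <= (c / x) `^ a * ((1 - t) / 2 * expR (x * u) + t / M * (u `^ r)^-1).
Proof.
move=> /andP[t0 t1] a0 art x0 u0 M0 cE.
have t1' : 0 < 1 - t by rewrite subr_gt0.
have c0 : 0 < c.
  rewrite cE; apply: mulr_gt0; first by rewrite divr_gt0// mulr_gt0 ?expR_gt0.
  by rewrite powR_gt0// mulr_gt0// powR_gt0.
(* In logarithms everything is linear: the [ln 2] and [ln M] terms of [c] cancel those of the two
   exponents, and what remains is [1 + a * (z - 1 - ln z)]. *)
have lnc : ln c = ln a - ln (1 - t) - 1 + ((1 - t) * ln 2 + t * ln M) / a.
  have e0 : 0 < (1 - t) * expR 1 by rewrite mulr_gt0 ?expR_gt0.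
  have w0 : 0 < 2 `^ (1 - t) * M `^ t by rewrite mulr_gt0 ?powR_gt0.
  rewrite cE lnM ?posrE ?powR_gt0 ?divr_gt0// ln_div ?posrE//.
  by rewrite ln_powR !lnM ?posrE ?powR_gt0 ?expR_gt0// expRK !ln_powR; ring.
pose L := a * (ln c - ln x).
have GE : (c / x) `^ a = expR L.
  by rewrite /powR gt_eqF ?divr_gt0// ln_div.
have -> : (c / x) `^ a * ((1 - t) / 2 * expR (x * u) + t / M * (u `^ r)^-1) =
    (1 - t) * expR (L + x * u - ln 2) + t * expR (L - ln M - r * ln u).
  rewrite GE !expRD !expRN !lnK ?posrE//.
  by rewrite {1}/powR gt_eqF//; field; rewrite !gt_eqF ?expR_gt0.
apply: (@le_trans _ _ ((1 - t) * (1 + (L + x * u - ln 2)) +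
    t * (1 + (L - ln M - r * ln u)))); last first.
  by apply: lerD; rewrite ler_pM2l// expR_ge1Dx.
have z0 : 0 < (1 - t) * x * u / a by rewrite divr_gt0// !mulr_gt0.
have z1 : -1 < (1 - t) * x * u / a - 1 by rewrite ltrBrDr addNr.
have := le_ln1Dx z1; rewrite addrCA subrr addr0 ln_div ?posrE ?mulr_gt0//.
rewrite !lnM ?posrE ?mulr_gt0// => lez.
have : a * (ln (1 - t) + ln x + ln u - ln a) <= (1 - t) * x * u - a.
  have -> : (1 - t) * x * u - a = a * ((1 - t) * x * u / a - 1) by field; rewrite gt_eqF.
  by rewrite ler_pM2l.
have -> : (1 - t) * (1 + (L + x * u - ln 2)) + t * (1 + (L - ln M - r * ln u)) =
  1 + (L + (1 - t) * x * u - (1 - t) * ln 2 - t * ln M - (r * t) * ln u) by ring.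
rewrite -art.
have -> : L = a * (ln a - ln (1 - t) - 1 - ln x) + ((1 - t) * ln 2 + t * ln M).
  by rewrite /L lnc; field; rewrite gt_eqF.
lra.
Qed.


End RealIntegrals.

Definition tail_prob {d : measure_display} {Omega : measurableType d}
  {R : realType} (P : probability Omega R) (f : Omega -> R) (x : R) : \bar R :=
  P [set w | x < f w].

(** * Layer-cake integration of tail probabilities *)

Section TailIntegration.
Context {d : measure_display} {Omega : measurableType d} {R : realType}.
Variable P : probability Omega R.
Local Notation leb := (@lebesgue_measure R).

Lemma measurable_superlevel (f : Omega -> R) (x : R) :
  measurable_fun setT f -> measurable [set w | x < f w].
Proof.
move=> mf; rewrite -[X in measurable X]setTI.
rewrite (_ : [set w | x < f w] = f @^-1` `]x, +oo[%classic); first exact: mf.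
by apply/seteqP; split => w /=; rewrite in_itv/= andbT.
Qed.

(** Bundles [f] as a random variable, so that facts about [ccdf] apply to plain measurable
    functions. *)
Lemma tail_ccdf (f : Omega -> R) (mf : measurable_fun setT f) :
  exists X : {RV P >-> R}, X = f :> (Omega -> R) /\ tail_prob P f = ccdf X.
Proof.
pose mixin := isMeasurableFun.Build _ _ _ _ _ mf.
pose X : {mfun Omega >-> R} := HB.pack f mixin.
exists X; split => //; apply/funext => x.
rewrite /tail_prob /ccdf /distribution /pushforward.
by congr (P _); apply/seteqP; split => w /=; rewrite in_itv/= andbT.
Qed.

Lemma measurable_tail_prob (f : Omega -> R) :
  measurable_fun setT f -> measurable_fun [set: R] (tail_prob P f).
Proof. by move=> /tail_ccdf[X [_ ->]]; exact: ccdf_measurable. Qed.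

Lemma integral_tail_prob (f : Omega -> R) :
  measurable_fun setT f -> (forall w, 0 <= f w) ->
  (\int[P]_w (f w)%:E = \int[leb]_(x in `[0%R, +oo[) tail_prob P f x)%E.
Proof.
move=> /tail_ccdf[X [<- tX]] X0.
have := @ge0_expectation_ccdf _ _ _ P X X0.
by rewrite expectation_def -tX.
Qed.

Lemma integral_tail_le (f : Omega -> R) (G : R -> \bar R) :
  measurable_fun setT f -> (forall w, 0 <= f w) ->
  measurable_fun [set: R] G ->
  (forall x, 0 <= x -> (tail_prob P f x <= G x)%E) ->
  (\int[P]_w (f w)%:E <= \int[leb]_(x in `[0%R, +oo[) G x)%E.
Proof.
move=> mf f0 mG fG; rewrite integral_tail_prob//; apply: ge0_le_integral => //.
- by apply: measurable_funTS; exact: measurable_tail_prob.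
- exact: measurable_funTS.
- by move=> x /=; rewrite in_itv/= andbT; exact: fG.
Qed.

End TailIntegration.

(** * Expectation bounds from an exponentially weighted tail estimate *)

Section AnytimeTail.
Context {d : measure_display} {Omega : measurableType d} {R : realType}.
Variables (P : probability Omega R) (f n : Omega -> R) (b : R).
Hypotheses (mf : measurable_fun setT f) (mn : measurable_fun setT n).
Hypotheses (f0 : forall w, 0 <= f w) (n0 : forall w, 0 <= n w).
Hypotheses (b0 : 0 < b) (bn : {ae P, forall w, b <= n w}).
Hypothesis tailP : forall x : R, 0 <= x ->
  (\int[P]_(w in [set w | (x < f w)%R]) (expR (x * n w))%:E <= 2%:E)%E.

Lemma measurable_expR_weight (x : R) D :
  measurable_fun D (fun w => (expR (x * n w))%:E).
Proof.
apply/measurable_funTS/measurable_EFinP/measurableT_comp => //.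
exact: measurable_funM.
Qed.

(** Exponential Markov inequality: on [D] the indicator is dominated by [c * expR (x * n)], whose
    integral is controlled by [tailP] on the larger event [x < f]. *)
Lemma tail_le_weight (x : R) (D : set Omega) (c : R) :
  0 <= x -> measurable D -> D `<=` [set w | x < f w] -> 0 <= c ->
  {ae P, forall w, D w -> 1 <= c * expR (x * n w)} ->
  (P D <= (2 * c)%:E)%E.
Proof.
move=> x0 mD Df c0 aeD.
rewrite -[P D]mul1e -integral_cst//.
apply: (@le_trans _ _ (\int[P]_(w in D) (c%:E * (expR (x * n w))%:E))%E).
  apply: ae_ge0_le_integral => //.
  - by move=> w _; rewrite -EFinM lee_fin mulr_ge0// expR_ge0.
  - exact/measurable_funeM/measurable_expR_weight.
rewrite ge0_integralZl//; last exact: measurable_expR_weight.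
rewrite mulrC EFinM lee_wpmul2l ?lee_fin//.
apply: le_trans (tailP x0); apply: ge0_subset_integral => //.
- exact: measurable_superlevel.
- exact: measurable_expR_weight.
Qed.

Local Notation leb := (@lebesgue_measure R).
Local Notation v := (fine (\int[P]_w ((n w)^-1)%:E)).

Lemma measurable_inv_weight : measurable_fun setT (fun w => (n w)^-1).
Proof.
rewrite (_ : (fun _ => _) = (fun x => x `^ (-1)) \o n).
  exact: (measurableT_comp (measurable_powR _)).
by apply/funext => w /=; rewrite powR_inv1.
Qed.

Lemma integral_inv_weight_le : (\int[P]_w ((n w)^-1)%:E <= (b^-1)%:E)%E.
Proof.
rewrite -[leRHS]mule1 -(probability_setT P) -integral_cst//.
apply: ae_ge0_le_integral => //.
- by move=> w _; rewrite lee_fin invr_ge0.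
- exact/measurable_EFinP/measurable_inv_weight.
- by move=> w _; rewrite lee_fin invr_ge0 ltW.
- apply: filterS bn => w bnw _.
  by rewrite lee_fin lef_pV2 ?posrE// (lt_le_trans b0).
Qed.

Lemma fin_num_inv_weight : (\int[P]_w ((n w)^-1)%:E)%E \is a fin_num.
Proof.
rewrite ge0_fin_numE; first exact: le_lt_trans integral_inv_weight_le (ltry _).
by apply: integral_ge0 => w _; rewrite lee_fin invr_ge0.
Qed.

Lemma anytime_risk_log :
  0 < v ->
  (\int[P]_w (f w)%:E <= (2 * v * (2 + ln (v^-1 / b)))%:E)%E.
Proof.
move=> v0; have vb1 : v * b <= 1.
  rewrite -ler_pdivlMr// div1r -lee_fin fineK ?fin_num_inv_weight//.
  exact: integral_inv_weight_le.
(* [k] inverts the ratio inside the logarithm: [- ln k = ln (v^-1 / b)], which is nonnegative by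
   [vb1]. *)
pose k := v * b; have k0 : 0 < k by exact: mulr_gt0.
pose g w := 2 * - ln k * (n w)^-1.
have lk : 0 <= - ln k by rewrite oppr_ge0 ln_le0.
have g0 w : 0 <= g w by rewrite !mulr_ge0// invr_ge0.
have mg : measurable_fun setT g.
  by apply: measurable_funM => //; exact: measurable_inv_weight.
have tail_fg x : 0 <= x ->
    (tail_prob P f x <= tail_prob P g x + (2 * k * expR (- (b / 2) * x))%:E)%E.
  move=> x0.
  have mf' := measurable_superlevel x mf; have mg' := measurable_superlevel x mg.
  rewrite /tail_prob.
  (* Split according to whether [x < g]: the first event integrates back to the expectation of [g],
     the second is exponentially small in [x]. *)
  apply: (@le_trans _ _ (P ([set w | x < g w] `|`
      ([set w | x < f w] `\` [set w | x < g w])))).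
    rewrite le_measure ?inE//; first by apply: measurableU => //; exact: measurableD.
    by move=> w fw; have [xg|xg] := pselect (x < g w); [left|right].
  apply: le_trans (measureU2 _ _ _) _ => //; first exact: measurableD.
  rewrite leeD2l// -mulrA; apply: (@tail_le_weight x) => //.
  - exact: measurableD.
  - by rewrite mulr_ge0 ?expR_ge0// ltW.
  apply: filterS bn => w bnw [/= _ /negP]; rewrite -leNgt => gx.
  rewrite -mulrA -expRD -[k]lnK// -expRD; apply: le_trans (expR_ge1Dx _).
  rewrite lerDl.
  (* Off [x < g] both [2 * - ln k] and [b * x] are at most [x * n w]; averaging the two bounds makes
     the remaining exponent nonnegative. *)
  have nw0 : 0 < n w by exact: lt_le_trans bnw.
  have : 2 * - ln k <= x * n w by move: gx; rewrite /g ler_pdivrMr.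
  have : b * x <= x * n w by rewrite mulrC ler_wpM2l.
  lra.
have mexp : measurable_fun [set: R] (fun x => (expR (- (b / 2) * x))%:E).
  by apply/measurable_EFinP/measurableT_comp.
have mkexp : measurable_fun [set: R]
    (fun x => (2 * k * expR (- (b / 2) * x))%:E).
  by under eq_fun do rewrite EFinM; exact: measurable_funeM.
apply: le_trans (integral_tail_le mf f0 _ tail_fg) _.
  by apply: emeasurable_funD => //; exact: measurable_tail_prob.
rewrite ge0_integralD//; last 3 first.
- by apply: measurable_funTS; exact: measurable_tail_prob.
- by move=> x _; rewrite lee_fin !mulr_ge0 ?expR_ge0// ltW.
- exact: measurable_funTS.
rewrite -integral_tail_prob//.
under [X in (_ + X)%E]eq_integral do rewrite EFinM.
rewrite ge0_integralZl//; last 2 first.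
- exact: measurable_funTS.
- by rewrite lee_fin mulr_ge0// ltW.
rewrite integral_expRN ?divr_gt0//.
under eq_integral do rewrite EFinM.
rewrite ge0_integralZl//; last 3 first.
- exact/measurable_EFinP/measurable_inv_weight.
- by move=> w _; rewrite lee_fin invr_ge0.
- by rewrite lee_fin mulr_ge0.
rewrite -[X in (_ * X + _)%E]fineK ?fin_num_inv_weight//.
rewrite -!EFinM -EFinD lee_fin -invfM lnV; last exact: k0.
rewrite -/k invf_div.
(* The factor [b] in [k] cancels the [1 / b] produced by the exponential integral, so this term too
   is a multiple of [v]. *)
have -> : 2 * k * (2 / b) = 4 * v by rewrite /k; field; rewrite gt_eqF.
by rewrite le_eqVlt; apply/orP; left; apply/eqP; ring.
Qed.

(** * The bound through the inverse moment of order [r] *)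

Section Power.
Variable r : R.
Hypothesis r1 : 1 < r.
Local Notation M := (fine (\int[P]_w (((n w) `^ r)^-1)%:E)).

Lemma measurable_inv_weight_pow : measurable_fun setT (fun w => ((n w) `^ r)^-1).
Proof.
under eq_fun do rewrite -powRN.
exact: (measurableT_comp (measurable_powR _)).
Qed.

Lemma fin_num_inv_weight_pow :
  (\int[P]_w (((n w) `^ r)^-1)%:E)%E \is a fin_num.
Proof.
rewrite ge0_fin_numE; last first.
  by apply: integral_ge0 => w _; rewrite lee_fin invr_ge0 powR_ge0.
apply: (@le_lt_trans _ _ ((b `^ r)^-1)%:E); last exact: ltry.
rewrite -[leRHS]mule1 -(probability_setT P) -integral_cst//.
apply: ae_ge0_le_integral => //.
- by move=> w _; rewrite lee_fin invr_ge0 powR_ge0.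
- exact/measurable_EFinP/measurable_inv_weight_pow.
- by move=> w _; rewrite lee_fin invr_ge0 powR_ge0.
- apply: filterS bn => w bnw _.
  have nw0 : 0 < n w by exact: lt_le_trans bnw.
  rewrite lee_fin lef_pV2 ?posrE ?powR_gt0//.
  by apply: ge0_ler_powR => //; rewrite ?nnegrE ltW// (lt_trans ltr01).
Qed.

(** Integrate [weighted_young] over the event [x < f]: the exponential term contributes at most
    [(1 - t) / 2 * 2], the moment term at most [t / M * M], and these add up to 1. *)
Lemma tail_prob_le_pow (t a c x : R) : 0 < M ->
  0 < t < 1 -> 0 < a -> a = r * t ->
  c = a / ((1 - t) * expR 1) * (2 `^ (1 - t) * M `^ t) `^ a^-1 ->
  0 < x -> (tail_prob P f x <= ((c / x) `^ a)%:E)%E.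
Proof.
move=> M0 t01 a0 art cE x0; set G := (c / x) `^ a.
have G0 : 0 <= G by exact: powR_ge0.
have /andP[t0 t1] := t01.
pose D := [set w | x < f w].
have mD : measurable D by exact: measurable_superlevel.
pose h1 w := (expR (x * n w))%:E; pose h2 w := (((n w) `^ r)^-1)%:E.
have h10 w : (0 <= h1 w)%E by rewrite lee_fin expR_ge0.
have h20 w : (0 <= h2 w)%E by rewrite lee_fin invr_ge0 powR_ge0.
have mh1 : measurable_fun D h1 by exact: measurable_expR_weight.
have mh2 : measurable_fun setT h2.
  exact/measurable_EFinP/measurable_inv_weight_pow.
have mh2D : measurable_fun D h2 by exact: measurable_funTS.
pose k1 := G * ((1 - t) / 2); pose k2 := G * (t / M).
have k10 : 0 <= k1 by rewrite mulr_ge0// divr_ge0// subr_ge0 ltW.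
have k20 : 0 <= k2 by rewrite mulr_ge0// divr_ge0// ltW.
rewrite /tail_prob -/D -[P D]mul1e -integral_cst//.
apply: (@le_trans _ _ (\int[P]_(w in D) (k1%:E * h1 w + k2%:E * h2 w))%E).
  apply: ae_ge0_le_integral => //.
  - by move=> w _; rewrite adde_ge0// mule_ge0// lee_fin.
  - by apply: emeasurable_funD; exact: measurable_funeM.
  apply: filterS bn => w bnw _.
  have nw0 : 0 < n w by exact: lt_le_trans bnw.
  rewrite -!EFinM -EFinD lee_fin.
  rewrite /k1 /k2 -!(mulrA G) -mulrDr.
  exact: weighted_young t01 a0 art x0 nw0 M0 cE.
rewrite ge0_integralD//; last 4 first.
- by move=> w _; rewrite mule_ge0// lee_fin.
- exact: measurable_funeM.
- by move=> w _; rewrite mule_ge0// lee_fin.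
- exact: measurable_funeM.
rewrite !ge0_integralZl//.
have I1 : (\int[P]_(w in D) h1 w <= 2%:E)%E by apply: tailP; exact: ltW.
have I2 : (\int[P]_(w in D) h2 w <= M%:E)%E.
  by rewrite fineK ?fin_num_inv_weight_pow//; exact: ge0_subset_integral.
apply: (@le_trans _ _ (k1%:E * 2%:E + k2%:E * M%:E)%E).
  by apply: leeD; exact: lee_wpmul2l.
rewrite -!EFinM -EFinD lee_fin /k1 /k2.
by rewrite le_eqVlt; apply/orP; left; apply/eqP; field; rewrite gt_eqF.
Qed.

(** The weight [t = 1 / q] turns the tail exponent into [a = r / q], which exceeds 1 exactly when
    [q < r], so the tail is integrable at infinity. *)
Lemma anytime_risk_pow (q : R) : 0 < M -> 1 < q < r ->
  (\int[P]_w (f w)%:E <=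
   (2 `^ (q / r) / expR 1 * (r ^+ 2 / ((r - q) * (q - 1))) * M `^ r^-1)%:E)%E.
Proof.
move=> M0 /andP[q1 qr].
have q0 : 0 < q by exact: lt_trans q1.
have r0 : 0 < r by exact: lt_trans r1.
have t01 : 0 < q^-1 < 1 by rewrite invr_gt0 q0 invf_lt1.
pose a := r / q.
have a1 : 1 < a by rewrite ltr_pdivlMr// mul1r.
have a0 : 0 < a by exact: lt_trans a1.
pose c := a / ((1 - q^-1) * expR 1) * (2 `^ (1 - q^-1) * M `^ q^-1) `^ a^-1.
have tailc x := @tail_prob_le_pow q^-1 a c x M0 t01 a0 erefl erefl.
have c0 : 0 < c.
  have /andP[_ t1] := t01.
  apply: mulr_gt0; last by rewrite powR_gt0// mulr_gt0// powR_gt0.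
  by rewrite divr_gt0// mulr_gt0 ?expR_gt0// subr_gt0.
rewrite integral_tail_prob//.
have tail0 x : (0 <= tail_prob P f x)%E by exact: measure_ge0.
have mtail : measurable_fun [set: R] (tail_prob P f) by exact: measurable_tail_prob.
(* Cut at [c], where [(c / x) ^ a] crosses 1: below it the trivial bound 1 is used, above it the
   power bound. *)
have -> : `[0, +oo[%classic = `[0, c[%classic `|` `[c, +oo[%classic :> set R.
  apply/seteqP; split => x /=; rewrite !in_itv/= !andbT.
    by move=> ->/=; have [|] := ltP x c; [left|right].
  by move=> [/andP[]//|]; apply: le_trans; exact: ltW.
rewrite ge0_integral_setU//; last 2 first.
- exact: measurable_funTS.
- apply/disj_setPRL => x /=; rewrite !in_itv/= andbT => cx /andP[_].
  by rewrite ltNge cx.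
apply: (@le_trans _ _ (c%:E + (c / (a - 1))%:E)%E).
  apply: leeD.
    apply: (@le_trans _ _ (\int[leb]_(x in `[0%R, c[) 1)%E).
      apply: ge0_le_integral => //; first exact: measurable_funTS.
      by move=> x _; exact: probability_le1 (measurable_superlevel _ mf).
    rewrite integral_cst//= mul1e lebesgue_measure_itv/= lte_fin c0.
    by rewrite -EFinD subr0.
  rewrite -integral_powR_tail//; apply: ge0_le_integral => //.
  - exact: measurable_funTS.
  - apply: measurable_funTS; apply/measurable_EFinP.
    by apply: measurable_funM => //; exact: measurable_powR.
  - move=> x /=; rewrite in_itv/= andbT => cx.
    have x0 : 0 < x by exact: lt_le_trans cx.
    apply: le_trans (tailc _ x0) _.
    rewrite lee_fin powRM ?invr_ge0; [|exact: ltW|exact: ltW].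
    by rewrite -(powR_inv1 (ltW x0)) -powRrM mulN1r.
rewrite -EFinD lee_fin.
have -> : c = r / ((q - 1) * expR 1) * (2 `^ ((q - 1) / r) * M `^ r^-1).
  rewrite /c powRM ?powR_ge0// -!powRrM /a.
  have -> : (1 - q^-1) * (r / q)^-1 = (q - 1) / r by field; rewrite !gt_eqF.
  have -> : q^-1 * (r / q)^-1 = r^-1 by field; rewrite !gt_eqF.
  congr (_ * _); field.
  by rewrite !gt_eqF ?expR_gt0 ?subr_gt0// mulrBr.
(* The computation yields the exponent [(q - 1) / r] on 2; it is weakened to [q / r] only to match
   the shape of [Cr]. *)
apply: (@le_trans _ _ (2 `^ ((q - 1) / r) / expR 1 *
    (r ^+ 2 / ((r - q) * (q - 1))) * M `^ r^-1)).
  rewrite le_eqVlt; apply/orP; left; apply/eqP; rewrite /a; field.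
  by rewrite !gt_eqF ?expR_gt0 ?subr_gt0.
rewrite ler_wpM2r ?powR_ge0// ler_wpM2r//.
  by rewrite divr_ge0 ?sqr_ge0// mulr_ge0// subr_ge0 ltW.
rewrite ler_wpM2r ?invr_ge0 ?expR_ge0//.
by rewrite ler_powR ?ler1n// ler_pM2r ?invr_gt0// gerBl.
Qed.

End Power.

End AnytimeTail.

(** * Likelihood supermartingales and optional stopping *)

Lemma measurable_stop_none {d : measure_display} {Omega : measurableType d}
  (T : Omega -> option nat) :
  (forall t, measurable [set w | T w = Some t]) ->
  measurable [set w | T w = None].
Proof.
move=> mT; rewrite (_ : mkset _ = \bigcap_t ~` [set w | T w = Some t]).
  by apply: bigcap_measurable => [|t _]; [exists 0%N|exact: measurableC].
apply/seteqP; split => w /= h; first by move=> t _ /=; rewrite h.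
by case E : (T w) => [t|//]; case: (h t I).
Qed.

Lemma measurable_at_time {d d' : measure_display} {Omega : measurableType d}
  {V : measurableType d'} (v0 : V) (X : nat -> Omega -> V)
  (T : Omega -> option nat) :
  (forall t, measurable [set w | T w = Some t]) ->
  (forall t, measurable_fun setT (X t)) ->
  measurable_fun setT (at_time v0 X T).
Proof.
move=> mT mX _ B mB; rewrite setTI.
rewrite (_ : _ @^-1` _ = (\bigcup_t ([set w | T w = Some t] `&` X t @^-1` B))
    `|` ([set w | T w = None] `&` [set _ | B v0])); last first.
  apply/seteqP; split => w; rewrite /at_time /=.
    by case E : (T w) => [t|] Bw; [left; exists t|right].
  by move=> [[t _ /= [-> //]]|[-> //]].
apply: measurableU.
  apply: bigcup_measurable => t _; apply: measurableI => //.
  by rewrite -[X in measurable X]setTI; exact: mX.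
apply: measurableI; first exact: measurable_stop_none.
have [Bv|Bv] := pselect (B v0).
  by rewrite (_ : mkset _ = setT)//; apply/seteqP; split.
by rewrite (_ : mkset _ = set0)//; apply/seteqP; split.
Qed.

Section BanditSupermartingale.
Context {R : realType} {d dW : measure_display} {Omega : measurableType d}
  {TW : measurableType dW} {K : nat}.
Variables (P : probability Omega R) (Pk : 'I_K -> probability R R)
  (W : Omega -> TW) (A : nat -> Omega -> 'I_K) (Y : nat -> Omega -> R).
Hypothesis model : bandit_model P Pk W A Y.

(** The sample space equipped with the sigma-algebra at time [t], so that adaptedness becomes
    [measurable_fun] with this source type. *)
Definition filtType (t : nat) := g_sigma_algebraType (hist_gen W A Y t).
HB.instance Definition _ t := Measurable.on (filtType t).

Lemma filt_measurable t E : filt W A Y t E -> measurable E.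
Proof.
have [mW mA mY _] := model.
apply: smallest_sub; first exact: sigma_algebra_measurable.
move=> _ [[B [mB ->]]|[[s [a [_ ->]]]|[s [B [_ [mB ->]]]]]].
- by rewrite -[X in measurable X]setTI; exact: mW.
- exact: mA.
- by rewrite -[X in measurable X]setTI; exact: mY.
Qed.

Lemma filt_arm t s a : (1 <= s <= t.+1)%N -> filt W A Y t [set w | A s w = a].
Proof. by move=> st; apply: sub_sigma_algebra; right; left; exists s, a. Qed.

Lemma filt_mono s t : (s <= t)%N -> filt W A Y s `<=` filt W A Y t.
Proof.
move=> st; apply: sub_sigma_algebra2 => E.
move=> [[B [mB ->]]|[[u [a [/andP[u1 us] ->]]]|[u [B [/andP[u1 us] [mB ->]]]]]].
- by left; exists B.
- by right; left; exists u, a; rewrite u1 (leq_trans us).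
- by right; right; exists u, B; rewrite u1 (leq_trans us).
Qed.

Lemma measurable_filt_id t : measurable_fun setT (id : Omega -> filtType t).
Proof. by move=> _ E mE; rewrite setTI; apply: filt_measurable mE. Qed.

Lemma measurable_reward t s : (1 <= s <= t)%N ->
  measurable_fun setT (Y s : filtType t -> R).
Proof.
move=> st _ B mB; rewrite setTI.
by apply: sub_sigma_algebra; right; right; exists s, B.
Qed.

Lemma measurable_arm t s a : (1 <= s <= t.+1)%N ->
  measurable_fun setT ((fun w => A s w == a) : filtType t -> bool).
Proof.
move=> st; apply: (measurable_fun_bool true).
rewrite setTI (_ : _ @^-1` _ = [set w | A s w = a]); first exact: filt_arm.
by apply/seteqP; split => w /= /eqP.
Qed.

(* Conditionally on [filt t] and [A t.+1 = a], the reward has law [Pk a]; hence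
   the law of [(w, Y t.+1 w)] on that event is a product measure. *)
Lemma integral_next_reward t a (G : filtType t -> \bar R) (phi : R -> \bar R) :
  measurable_fun setT G -> (forall w, 0 <= G w)%E ->
  (forall w, A t.+1 w != a -> G w = 0%E) ->
  measurable_fun setT phi -> (forall y, 0 <= phi y)%E ->
  (\int[P]_w (G w * phi (Y t.+1 w)) = \int[P]_w G w * \int[Pk a]_y phi y)%E.
Proof.
move=> mG G0 Ga mphi phi0.
have [_ _ mY /(_ t.+1 isT) indep] := model.
pose D : set (filtType t) := [set w | A t.+1 w = a].
have mD : measurable D by apply: filt_arm; rewrite /= leqnn.
pose idmixin := isMeasurableFun.Build _ _ _ _ _ (@measurable_filt_id t).
pose idF : {mfun Omega >-> filtType t} := HB.pack (id : Omega -> filtType t) idmixin.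
have mPhi : measurable_fun [set: Omega] (fun w : Omega => (idF w, Y t.+1 w)).
  by apply: measurable_fun_pair.
pose Phimixin := isMeasurableFun.Build _ _ _ _ _ mPhi.
pose Phi : {mfun Omega >-> (filtType t * R)%type} :=
  HB.pack (fun w : Omega => (idF w, Y t.+1 w)) Phimixin.
pose PF := distribution P idF; pose PFD := mrestr PF mD.
pose DR := D `*` [set: R].
have mDR : measurable DR by exact: measurableX.
pose PPhi := distribution P Phi.
(* By uniqueness of the product measure only rectangles need checking, and there the identity is the
   model hypothesis [indep]. *)
have prodE X : measurable X -> (PFD \x Pk a)%E X = mrestr PPhi mDR X.
  apply: product_measure_unique => E B mE mB.
  apply: etrans (indep E mE a B mB).
  rewrite -[LHS]/(P (Phi @^-1` ((E `*` B) `&` DR))); congr (P _).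
  by apply/seteqP; split => w /= => [[[? ?] [? _]]|[[? ?] ?]].
pose g (z : filtType t * R) := (G z.1 * phi z.2)%E.
have mg : measurable_fun setT g.
  by apply: emeasurable_funM; exact: measurableT_comp.
have g0 z : (0 <= g z)%E by rewrite mule_ge0.
transitivity (\int[PPhi]_z g z)%E.
  by rewrite ge0_integral_distribution.
transitivity (\int[PFD \x Pk a]_z g z)%E.
  (* [G] vanishes off [D], so both integrals may be restricted to [DR], where [prodE] identifies the
     two measures. *)
  have gDR : g = g \_ DR.
    apply/funext => -[w y]; rewrite patchE; case: ifPn => // /negP wD.
    rewrite /g/= Ga ?mul0e//; apply/eqP => wa; apply: wD.
    by rewrite inE; split.
  rewrite gDR -!integral_mkcond; apply: eq_measure_integral => X mX XD.
  apply: etrans (esym (prodE X mX)).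
  by rewrite -[RHS]/(PPhi (X `&` DR)) setIidl.
rewrite fubini_tonelli1//.
transitivity (\int[PFD]_w (G w * \int[Pk a]_y phi y))%E.
  by apply: eq_integral => w _; rewrite /fubini_F /g/= ge0_integralZl.
rewrite ge0_integralZr//; last exact: integral_ge0.
congr (_ * _)%E.
transitivity (\int[PF]_w G w)%E; last by rewrite ge0_integral_distribution.
have GD : G = G \_ D.
  apply/funext => w; rewrite patchE; case: ifPn => // /negP wD.
  by rewrite Ga//; apply/eqP => wa; apply: wD; rewrite inE.
rewrite GD -!integral_mkcond; apply: eq_measure_integral => X mX XD.
by rewrite -[LHS]/(PF (X `&` D)) setIidl.
Qed.

(** * The likelihood process of one arm *)

Section LikelihoodProcess.
Variables (k : 'I_K) (phi : R -> R).
Hypotheses (mphi : measurable_fun setT phi) (phi0 : forall y, 0 <= phi y).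
Hypothesis phi1 : (\int[Pk k]_y (phi y)%:E <= 1)%E.

(** Only pulls of arm [k] contribute a factor. The intended [phi] is the exponential tilt of
    [Lproc_exp], but all that matters for stopping is that [phi] is nonnegative with mean at most
    1. *)
Definition Lproc (t : nat) (w : Omega) : R :=
  \prod_(1 <= s < t.+1) (if A s w == k then phi (Y s w) else 1).

Lemma LprocS t w :
  Lproc t.+1 w = Lproc t w * (if A t.+1 w == k then phi (Y t.+1 w) else 1).
Proof. by rewrite /Lproc big_nat_recr. Qed.

Lemma Lproc_ge0 t w : 0 <= Lproc t w.
Proof. by apply: prodr_ge0 => s _; case: ifP. Qed.

Lemma measurable_Lproc_filt t :
  measurable_fun setT (Lproc t : filtType t -> R).
Proof.
apply: measurable_prod => s; rewrite mem_index_iota => st.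
apply: measurable_fun_ifT => //.
- by apply: measurable_arm; case/andP: st => -> /=; exact: leqW.
- by apply: measurableT_comp => //; exact: measurable_reward.
Qed.

Lemma measurable_Lproc t D : measurable_fun D (EFin \o Lproc t : Omega -> \bar R).
Proof.
apply: measurable_funTS; apply/measurable_EFinP.
move=> _ B mB; apply: (@filt_measurable t).
by have := @measurable_Lproc_filt t measurableT B mB.
Qed.

(** Where the next pull is arm [k], the new factor has conditional mean at most 1; elsewhere the
    process does not move. Integrating over events of the filtration replaces conditional
    expectations. *)
Lemma Lproc_supermartingale t E : filt W A Y t E ->
  (\int[P]_(w in E) (Lproc t.+1 w)%:E <= \int[P]_(w in E) (Lproc t w)%:E)%E.
Proof.
move=> mE; pose D := [set w | A t.+1 w = k].
have mD : filt W A Y t D by apply: filt_arm; rewrite /= leqnn.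
have mED : filt W A Y t (E `&` D) := @measurableI _ (filtType t) _ _ mE mD.
have mED' : filt W A Y t (E `\` D) := @measurableD _ (filtType t) _ _ mE mD.
have EE : E = (E `&` D) `|` (E `\` D) by rewrite setUIDK.
have split (f : Omega -> R) : measurable_fun setT (EFin \o f) -> (forall w, 0 <= f w) ->
    (\int[P]_(w in E) (f w)%:E = \int[P]_(w in E `&` D) (f w)%:E +
      \int[P]_(w in E `\` D) (f w)%:E)%E.
  move=> mf f0; rewrite {1}EE ge0_integral_setU//.
  - exact: filt_measurable mED.
  - exact: filt_measurable mED'.
  - exact: measurable_funTS.
  - by move=> w _; rewrite lee_fin.
  - by apply/disj_setPS => w [[_ ?] []].
rewrite !split; [|exact: measurable_Lproc|exact: Lproc_ge0|
  exact: measurable_Lproc|exact: Lproc_ge0].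
apply: leeD; last first.
  rewrite le_eqVlt; apply/orP; left; apply/eqP; apply: eq_integral => w.
  rewrite inE => -[_ /eqP/negbTE wk]; by rewrite LprocS wk mulr1.
(* The past restricted to [E] and to the pull of [k]: known before the reward is drawn, and zero off
   that pull, as [integral_next_reward] demands. *)
pose G : filtType t -> \bar R := (EFin \o Lproc t) \_ (E `&` D).
have mG : measurable_fun setT G.
  have mEDt : measurable (E `&` D : set (filtType t)) by exact: mED.
  apply/(measurable_restrictT (EFin \o (Lproc t : filtType t -> R)) mEDt).
  have mLt := @measurable_Lproc_filt t; move/measurable_EFinP : mLt => mLt.
  exact: measurable_funTS mLt.
have G0 w : (0 <= G w)%E.
  by rewrite /G patchE; case: ifP => // _; rewrite lee_fin Lproc_ge0.
have Gk w : A t.+1 w != k -> G w = 0%E.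
  move=> /eqP wk; rewrite /G patchE; case: ifP => //; rewrite inE => -[_ //].
have := @integral_next_reward t k G (EFin \o phi) mG G0 Gk.
move=> /(_ _ _)/wrap[||GE].
- exact/measurable_EFinP.
- by move=> y; rewrite lee_fin.
rewrite [leRHS]integral_mkcond -/G -[leRHS]mule1.
apply: (@le_trans _ _ (\int[P]_w G w * \int[Pk k]_y (phi y)%:E)%E); last first.
  by apply: lee_wpmul2l => //; exact: integral_ge0.
rewrite -GE [leLHS]integral_mkcond le_eqVlt; apply/orP; left; apply/eqP.
apply: eq_integral => w _; rewrite /G !patchE; case: ifPn; last by rewrite mul0e.
by rewrite inE => -[_ /= wk]; rewrite LprocS wk eqxx EFinM.
Qed.

(** * Stopping the likelihood process *)

Variable T : Omega -> option nat.
Hypothesis stopT : as_finite_stopping_time P W A Y T.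

Let stop t := [set w | T w = Some t].
(** The event that [T] is at least [n], with [T = None] included. The event [running n.+1] excludes
    only stops at times up to [n], hence is already known at time [n]. *)
Let running n := [set w | forall t, (t < n)%N -> T w <> Some t].

Let mstop t : filt W A Y t (stop t). Proof. by have [] := stopT. Qed.

Let mrunning n : filt W A Y n (running n.+1).
Proof.
rewrite (_ : running n.+1 = \bigcap_(t in [set t | (t < n.+1)%N]) ~` stop t); last first.
  by apply/seteqP; split => w h t /= tn; exact: h.
apply: (@bigcap_measurable _ (filtType n)) => [|t tn]; first by exists 0%N.
apply: (@measurableC _ (filtType n)).
have tn' : (t <= n)%N by [].
exact: (@filt_mono _ _ tn' _ (@mstop t)).
Qed.

(** Optional stopping at the bounded time [min (T, n)], written out by the value of [T]. Each
    induction step splits [stop n] off [running n] and applies the supermartingale inequality on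
    [running n.+1]. *)
Lemma stopped_sum_le n :
  (\sum_(t < n) \int[P]_(w in stop t) (Lproc t w)%:E +
   \int[P]_(w in running n) (Lproc n w)%:E <= 1)%E.
Proof.
elim: n => [|n IHn].
  rewrite big_ord0 add0e (_ : running 0 = setT); last by apply/seteqP; split.
  under eq_integral do rewrite /Lproc big_geq//.
  by rewrite integral_cst//= probability_setT mule1.
apply: le_trans IHn; rewrite big_ord_recr/= -addeA leeD2l//.
have -> : running n = stop n `|` running n.+1.
  apply/seteqP; split => [w h|w [/= Tn t tn|h t tn]].
  - have [Tn|Tn] := pselect (T w = Some n); first by left.
    right=> t; rewrite ltnS leq_eqVlt => /orP[/eqP->//|]; exact: h.
  - by rewrite Tn => -[nt]; rewrite nt ltnn in tn.
  - by apply: h; exact: ltnW.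
rewrite ge0_integral_setU//; last 5 first.
- exact: filt_measurable (@mstop n).
- exact: filt_measurable (@mrunning n).
- exact: measurable_Lproc.
- by move=> w _; rewrite lee_fin Lproc_ge0.
- by apply/disj_setPS => w [/= Tn h]; exact: (h n _ Tn).
by rewrite leeD2l// Lproc_supermartingale.
Qed.

(** Nonnegativity lets the running term of [stopped_sum_le] be dropped; the remaining sums over the
    values of [T] increase to the full integral, up to the null event [T = None]. *)
Lemma optional_stopping (v0 : R) : 0 <= v0 ->
  (\int[P]_w (at_time v0 Lproc T w)%:E <= 1)%E.
Proof.
move=> v00; have [_ Tnone] := stopT.
have mnone : measurable [set w | T w = None].
  by apply: measurable_stop_none => t; exact: filt_measurable (@mstop t).
have mL : measurable_fun setT (fun w => (at_time v0 Lproc T w)%:E).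
  apply/measurable_EFinP/measurable_at_time => t.
    exact: filt_measurable (@mstop t).
  by apply/measurable_EFinP; exact: measurable_Lproc.
rewrite (@ge0_negligible_integral _ _ _ _ _ [set w | T w = None])//; last first.
  by move=> w _; rewrite lee_fin /at_time; case: (T w) => // t; exact: Lproc_ge0.
have -> : setT `\` [set w | T w = None] = \bigcup_t stop t.
  apply/seteqP; split => w /=; last by move=> [t _]; rewrite /stop/= => ->.
  by move=> [_]; case E : (T w) => [t|//] _; exists t.
rewrite ge0_integral_bigcup//; last 4 first.
- by move=> t; exact: filt_measurable (@mstop t).
- exact: measurable_funTS.
- by move=> w _; rewrite lee_fin /at_time; case: (T w) => // t; exact: Lproc_ge0.
- by move=> i j _ _ [w []]; rewrite /stop/= => -> [].
apply: lime_le.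
  apply: is_cvg_nneseries => t _ _; apply: integral_ge0 => w _.
  by rewrite lee_fin /at_time; case: (T w) => // ?; exact: Lproc_ge0.
apply: nearW => n; apply: le_trans (stopped_sum_le n).
rewrite big_mkord -[leLHS]adde0; apply: leeD.
  apply: lee_sum => t _; rewrite le_eqVlt; apply/orP; left; apply/eqP.
  by apply: eq_integral => w; rewrite inE /at_time => ->.
by apply: integral_ge0 => w _; rewrite lee_fin Lproc_ge0.
Qed.

End LikelihoodProcess.
End BanditSupermartingale.

(** * Convex conjugates *)

Section PsiStar.
Context {R : realType}.
Variables (psi : R -> R) (lmin lmax : \bar R) (mu : R).
Hypothesis psiP : CGF_like psi lmin lmax.
Let Lam := [set l : R | (lmin < l%:E < lmax)%E].

Lemma cgf_Lam0 : Lam 0. Proof. by have [] := psiP. Qed.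

Lemma cgf_ge0 l : Lam l -> 0 <= psi l. Proof. by have [_ + _ _ _] := psiP; exact. Qed.

Lemma cgf_0 : psi 0 = 0. Proof. by have [_ _ _ _ []] := psiP. Qed.

Lemma cgf_Lam_scale l s : Lam l -> 0 <= s <= 1 -> Lam (s * l).
Proof.
rewrite /Lam/= => /andP[l1 l2] /andP[s0 s1].
have /andP[z1 z2] := cgf_Lam0.
have [l0|l0] := leP 0 l; apply/andP; split.
- by apply: lt_le_trans z1 _; rewrite lee_fin mulr_ge0.
- by apply: le_lt_trans l2; rewrite lee_fin ler_piMl.
- by apply: lt_le_trans l1 _; rewrite lee_fin ler_niMl// ltW.
- by apply: le_lt_trans z2; rewrite lee_fin mulr_ge0_le0// ltW.
Qed.

(** Convexity against the point 0, where [psi] vanishes. The strict form in [CGF_like] forces the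
    cases [s = 0], [s = 1] and [l = 0] to be treated apart. *)
Lemma cgf_scale_le l s : Lam l -> 0 <= s <= 1 -> psi (s * l) <= s * psi l.
Proof.
move=> Ll /andP[]; rewrite le_eqVlt => /predU1P[<- _|s0].
  by rewrite !mul0r cgf_0.
rewrite le_eqVlt => /predU1P[->|s1]; first by rewrite !mul1r.
have [->|l0] := eqVneq l 0; first by rewrite mulr0 cgf_0 mulr0.
have [_ _ _ /(_ l 0 s Ll cgf_Lam0 l0) + _] := psiP.
by rewrite s0 s1 mulr0 addr0 cgf_0 mulr0 addr0 => /(_ isT)/ltW.
Qed.

(** The interval may be asymmetric or unbounded; [derive_psi_star] needs an arbitrarily small slope
    admissible with both signs. *)
Lemma cgf_symmetric_nbhs (e : R) : 0 < e ->
  exists2 e', 0 < e' <= e & Lam e' /\ Lam (- e').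
Proof.
move=> e0; have /andP[] := cgf_Lam0.
have aux (m : \bar R) : (0 < m)%E -> exists2 r : R, 0 < r & (r%:E < m)%E.
  case: m => [m| |]//; last by move=> _; exists 1; rewrite ?ltry.
  by rewrite lte_fin => m0; exists (m / 2); rewrite ?lte_fin; lra.
move=> lmin0 /aux[r r0 rl].
have /aux[s s0 sl] : (0 < - lmin)%E by rewrite oppe_gt0.
pose m := Num.min e (Num.min r s).
have m0 : 0 < m by rewrite !lt_min e0 r0 s0.
have mr : m <= r by rewrite !ge_min lexx orbT.
have ms : m <= s by rewrite !ge_min lexx !orbT.
exists m; first by rewrite m0 ge_min lexx.
split; apply/andP; split.
- by apply: lt_trans lmin0 _; rewrite lte_fin.
- by apply: le_lt_trans rl; rewrite lee_fin.
- by rewrite EFinN lteNr; apply: le_lt_trans sl; rewrite lee_fin.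
- by apply: lt_trans (_ : (0 < lmax)%E); [rewrite lte_fin oppr_lt0|exact: lt_trans rl].
Qed.

(** Strict convexity at the midpoint of 0 and [l] gives [0 <= psi (l / 2) < psi l / 2]. *)
Lemma cgf_gt0 l : Lam l -> l != 0 -> 0 < psi l.
Proof.
move=> Ll l0; have [_ _ _ /(_ l 0 2^-1 Ll cgf_Lam0 l0) + _] := psiP.
rewrite invr_gt0 ltr0n invf_lt1// ltr1n mulr0 addr0 cgf_0 mulr0 addr0.
move=> /(_ isT) h.
have : 0 <= psi (2^-1 * l).
  by apply: cgf_ge0; apply: cgf_Lam_scale => //; lra.
by lra.
Qed.

Lemma lt_psi_star x z :
  (x%:E < psi_star psi lmin lmax mu z)%E <->
  exists2 l, Lam l & x < l * (z - mu) - psi l.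
Proof.
split=> [/ereal_sup_gt[_ [l Ll <-]]|[l Ll xl]].
  by rewrite lte_fin /psi_mu => h; exists l => //; rewrite mulrBr; lra.
apply: (@lt_le_trans _ _ (l * z - psi_mu psi mu l)%:E).
  by rewrite lte_fin /psi_mu; move: xl; rewrite mulrBr; lra.
by apply: ereal_sup_ubound; exists l.
Qed.

Lemma psi_star_ge0 z : (0 <= psi_star psi lmin lmax mu z)%E.
Proof.
apply: ereal_sup_ubound; exists 0; first exact: cgf_Lam0.
by rewrite /psi_mu !mul0r cgf_0 addr0 subr0.
Qed.

(** A supremum of affine functions is lower semicontinuous: a slope exceeding [a] at [z] still does
    so nearby. *)
Lemma measurable_psi_star : measurable_fun [set: R] (psi_star psi lmin lmax mu).
Proof.
apply: lower_semicontinuous_measurable => z a /lt_psi_star[l Ll al].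
have cl : continuous (fun y => l * (y - mu) - psi l).
  move=> y; apply: cvgB; last exact: cvg_cst.
  by apply: cvgMr; apply: cvgB; [exact: cvg_id|exact: cvg_cst].
exists [set y | a < l * (y - mu) - psi l]; last first.
  by move=> y ay; apply/lt_psi_star; exists l.
exact: (cvgr_gt _ (cl z) _ al).
Qed.

(** Slopes with [|l| <= e] give at most [e * |z - mu|]. For steeper ones, shrinking [l] to [e] or
    [-e] and using convexity shows [psi l >= |l| * |z - mu|], so their contribution is
    nonpositive. *)
Lemma psi_star_le z e : 0 < e -> Lam e -> Lam (- e) ->
  `|z - mu| <= Num.min (psi e) (psi (- e)) / e ->
  (psi_star psi lmin lmax mu z <= (e * `|z - mu|)%:E)%E.
Proof.
move=> e0 Le LNe; rewrite ler_pdivlMr// le_min => /andP[ze zNe].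
apply: ge_ereal_sup => _ [l Ll <-]; rewrite lee_fin.
have -> : l * z - psi_mu psi mu l = l * (z - mu) - psi l by rewrite /psi_mu; ring.
have p0 := cgf_ge0 Ll.
have ly : l * (z - mu) <= `|l| * `|z - mu| by rewrite -normrM ler_norm.
have [le|le] := leP `|l| e.
  have : `|l| * `|z - mu| <= e * `|z - mu| by rewrite ler_wpM2r.
  lra.
have l0 : 0 < `|l| by exact: lt_trans le.
have s01 : 0 <= e / `|l| <= 1.
  apply/andP; split; first by rewrite divr_ge0// ltW.
  by rewrite ler_pdivrMr// mul1r ltW.
have := cgf_scale_le Ll s01.
have : `|z - mu| * e <= psi (e / `|l| * l).
  have ln0 : l != 0 by rewrite -normr_gt0.
  have [lp|ln] := leP 0 l.
    by rewrite (ger0_norm lp) divfK.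
  by rewrite (ltr0_norm ln) invrN mulrN mulNr divfK.
move=> h1 h2; have : `|z - mu| * e <= e / `|l| * psi l by exact: le_trans h2.
rewrite mulrAC ler_pdivlMr// [X in _ <= X]mulrC mulrAC ler_pM2r// => h3.
have : 0 <= e * `|z - mu| by rewrite mulr_ge0// ltW.
move: h3 ly; rewrite [`|z - mu| * _]mulrC; lra.
Qed.

Lemma psi_star_mu : psi_star psi lmin lmax mu mu = 0%E.
Proof.
apply/eqP; rewrite eq_le psi_star_ge0 andbT.
apply: ge_ereal_sup => _ [l Ll <-]; rewrite lee_fin /psi_mu.
have := cgf_ge0 Ll; lra.
Qed.

(** By [psi_star_le], for each [e] the conjugate lies between 0 and [e * |z - mu|] near [mu], so the
    difference quotients tend to 0. *)
Lemma derive_psi_star : derive1 (fun z => fine (psi_star psi lmin lmax mu z)) mu = 0.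
Proof.
rewrite derive1E /derive; apply: cvg_lim => //.
rewrite psi_star_mu/=; apply/cvgrPdist_le => e e0.
have [e' /andP[e'0 e'e] [Le LNe]] := cgf_symmetric_nbhs e0.
pose eta := Num.min (psi e') (psi (- e')) / e'.
have eta0 : 0 < eta.
  by rewrite divr_gt0// lt_min !cgf_gt0// ?oppr_eq0 gt_eqF.
near=> h.
have h0 : h != 0 by near: h; exact: nbhs_dnbhs_neq.
have heta : `|h| <= eta by near: h; exact: dnbhs0_le.
have zh : h *: 1 + mu - mu = h by rewrite addrK /GRing.scale/= mulr1.
have := @psi_star_le (h *: 1 + mu) e' e'0 Le LNe.
rewrite zh => /(_ heta); have := psi_star_ge0 (h *: 1 + mu).
case: (psi_star psi lmin lmax mu (h *: 1 + mu)) => [v| |]//=.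
rewrite !lee_fin => v0 ve; rewrite subr0 sub0r normrN normrZ normfV.
rewrite (ger0_norm v0) mulrC ler_pdivrMr ?normr_gt0//.
by apply: le_trans ve _; rewrite ler_wpM2r.
Unshelve. all: by end_near.
Qed.

Lemma bregmanE z : bregman psi lmin lmax mu z = psi_star psi lmin lmax mu z.
Proof. by rewrite /bregman derive_psi_star psi_star_mu/= mul0r !sube0. Qed.

End PsiStar.

(** * Tail of the stopped divergence *)

(* A single slope [l] certifies the crossing for all larger values of [X], so
   the supremum over slopes costs nothing. *)
Lemma integral_crossing_le1 {R : realType} {d : measure_display}
  {Omega : measurableType d} (P : probability Omega R) (X n : Omega -> R)
  (Lam : set R) (psi : R -> R) (x : R) :
  measurable_fun setT X -> measurable_fun setT n -> (forall w, 0 <= n w) ->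
  (forall l, Lam l -> 0 < l /\ 0 <= psi l) -> 0 <= x ->
  (forall l, Lam l ->
     (\int[P]_w (expR (n w * (l * X w - psi l)))%:E <= 1)%E) ->
  let U := [set w | exists2 l, Lam l & x < l * X w - psi l] in
  measurable U /\ (\int[P]_(w in U) (expR (x * n w))%:E <= 1)%E.
Proof.
move=> mX mn n0 Lam0 x0 intL U.
(* [I] collects the deviations at which some slope certifies the crossing. It is an up-closed set
   without least element, hence empty or an open half-line when bounded below. *)
pose I := [set z : R | exists2 l, Lam l & x < l * z - psi l].
have Iup z z' : I z -> z <= z' -> I z'.
  move=> [l Ll xl] zz'; exists l => //; apply: lt_le_trans xl _.
  by rewrite lerD2r ler_wpM2l// ltW//; case: (Lam0 _ Ll).
have I0 z : I z -> 0 <= z.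
  move=> [l Ll xl]; have [l0 p0] := Lam0 _ Ll.
  rewrite -(pmulr_rge0 _ l0); apply: le_trans x0 _; apply: le_trans (ltW xl) _.
  by rewrite gerBl.
have Iopen z : I z -> exists2 z', I z' & z' < z.
  move=> [l Ll xl]; have [l0 p0] := Lam0 _ Ll.
  (* Moving left by this amount uses up half of the slack in [x < l * z - psi l], so the same slope
     still works. *)
  exists (z - (l * z - psi l - x) / 2 / l); last first.
    by rewrite ltrBlDr ltrDl !divr_gt0// subr_gt0.
  exists l => //; rewrite mulrBr mulrCA divff ?gt_eqF// mulr1.
  by move: xl; lra.
have [I_0|/set0P[z0 Iz0]] := eqVneq I set0.
  have -> : U = set0.
    by apply/seteqP; split => // w Uw; have : I (X w) by []; rewrite I_0.
  by rewrite integral_set0.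
have infI : has_inf I by split; [exists z0|exists 0 => z; exact: I0].
(* Closed half-lines exhaust the open one. On each [F i] a single slope, chosen at the left
   endpoint, works throughout since slopes are positive; monotone convergence then reaches [U]. *)
pose a := inf I; pose F i := [set w | a + i.+1%:R^-1 <= X w].
have IF i : I (a + i.+1%:R^-1).
  have i0 : 0 < i.+1%:R^-1 :> R by rewrite invr_gt0.
  by have [z Iz /ltW za] := inf_adherent i0 infI; exact: Iup za.
have mF i : measurable (F i).
  rewrite -[X in measurable X]setTI.
  rewrite (_ : F i = X @^-1` `[a + i.+1%:R^-1, +oo[%classic); first exact: mX.
  by apply/seteqP; split => w /=; rewrite in_itv/= andbT.
have UF : U = \bigcup_i F i.
  apply/seteqP; split => w /=; last by move=> [i _ aX]; exact: (Iup _ _ (IF i)).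
  move=> /(Iopen (X w))[z Iz zX].
  have /ltr_add_invr[i ai] : a < X w.
    by apply: le_lt_trans zX; apply: ge_inf => //; case: infI.
  by exists i => //; exact: ltW.
have me D : measurable_fun D (fun w => (expR (x * n w))%:E).
  apply/measurable_funTS/measurable_EFinP/measurableT_comp => //.
  exact: measurable_funM.
have ndF : nondecreasing_seq F.
  move=> i j ij; apply/subsetPset => w /=; apply: le_trans.
  by rewrite lerD2l lef_pV2 ?posrE// ler_nat ltnS.
split; first by rewrite UF; exact: bigcup_measurable.
rewrite UF.
have cvgF := @ge0_nondecreasing_set_cvg_integral _ _ _ F _ P ndF mF
  (fun i => me (F i)) (fun _ _ _ => expR_ge0 _).
rewrite -(cvg_lim _ cvgF)//; apply: lime_le; first by apply: cvgP; exact: cvgF.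
apply: nearW => i; have [l Ll xl] := IF i; have [l0 p0] := Lam0 _ Ll.
have mel : measurable_fun setT (fun w => (expR (n w * (l * X w - psi l)))%:E).
  apply/measurable_EFinP/measurableT_comp => //; apply: measurable_funM => //.
  by apply: measurable_funB => //; exact: measurable_funM.
apply: le_trans (intL _ Ll).
apply: (@le_trans _ _ (\int[P]_(w in F i) (expR (n w * (l * X w - psi l)))%:E)%E).
  apply: ge0_le_integral => //; first exact: measurable_funTS.
  move=> w Fw; rewrite lee_fin ler_expR mulrC ler_wpM2l//.
  apply: le_trans (ltW xl) _; rewrite lerD2r ler_wpM2l//; exact: ltW.
by apply: ge0_subset_integral.
Qed.

(** A zero integral would force [g = 0] almost everywhere, making the whole space null. It ensures
    that the inverse moments defining the effective sample sizes are positive. *)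
Lemma integral_gt0 {R : realType} {d : measure_display} {Omega : measurableType d}
  (P : probability Omega R) (g : Omega -> R) :
  measurable_fun setT g -> (forall w, 0 <= g w) ->
  {ae P, forall w, 0 < g w} -> (0 < \int[P]_w (g w)%:E)%E.
Proof.
move=> mg g0 gpos; rewrite lt0e integral_ge0 ?andbT; last first.
  by move=> w _; rewrite lee_fin.
apply/eqP => int0.
have mG : measurable_fun setT (EFin \o g) by exact/measurable_EFinP.
have : ae_eq P setT (EFin \o g) (cst 0%E).
  apply/(ae_eq_integral_abs _ measurableT mG).
  by rewrite -[RHS]int0; apply: eq_integral => w _ /=; rewrite ger0_norm.
move=> aeg.
have : {ae P, forall w : Omega, False}.
  apply: filterS2 aeg gpos => w /(_ I) [->]; by rewrite ltxx.
move=> [Z [mZ Z0 FZ]].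
have ZT : Z = setT by apply/seteqP; split => // w _; apply: FZ; exact.
by move: Z0; rewrite ZT probability_setT => -[/eqP]; rewrite oner_eq0.
Qed.

(** * The bandit process at the stopping time *)

Section StoppedBandit.
Context {R : realType} {d dW : measure_display} {Omega : measurableType d}
  {TW : measurableType dW} {K : nat}.
Variables (P : probability Omega R) (Pk : 'I_K -> probability R R)
  (W : Omega -> TW) (A : nat -> Omega -> 'I_K) (Y : nat -> Omega -> R)
  (T : Omega -> option nat) (psi : R -> R) (lmin lmax : \bar R) (k : 'I_K).
Hypotheses (model : bandit_model P Pk W A Y)
  (stopT : as_finite_stopping_time P W A Y T).

Lemma measurable_stopped {d' : measure_display} {V : measurableType d'} (v0 : V)
  (X : nat -> Omega -> V) :
  (forall t, measurable_fun setT (X t)) -> measurable_fun setT (at_time v0 X T).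
Proof.
apply: measurable_at_time => t; apply: (filt_measurable model).
by have [] := stopT; exact.
Qed.

Lemma measurable_arm_bool s : measurable_fun setT (fun w => A s w == k).
Proof.
apply: (measurable_fun_bool true); rewrite setTI.
rewrite (_ : _ @^-1` _ = [set w | A s w = k]); last first.
  by apply/seteqP; split => w /= /eqP.
by have [_ mA _ _] := model.
Qed.

Lemma measurable_Ncount t : measurable_fun setT (fun w => (Ncount A k t w)%:R : R).
Proof.
under eq_fun do rewrite /Ncount natr_sum.
apply: measurable_sum => s; under eq_fun do rewrite mulrb.
by apply: measurable_fun_ifT => //; exact: measurable_arm_bool.
Qed.

Lemma measurable_muhat t : measurable_fun setT (muhat A Y k t : Omega -> R).
Proof.
apply: measurable_funM.
  apply: measurable_sum => s; apply: measurable_fun_ifT => //.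
    exact: measurable_arm_bool.
  by have [_ _ mY _] := model.
under eq_fun do rewrite -powR_inv1//.
exact: (measurableT_comp (measurable_powR _) (measurable_Ncount t)).
Qed.

Lemma Ncount_mono s t w : (s <= t)%N -> (Ncount A k s w <= Ncount A k t w)%N.
Proof.
by move=> st; rewrite /Ncount (@big_cat_nat _ _ _ s.+1 1 t.+1)//= leq_addr.
Qed.

Lemma muhat_Ssum (mu : R) t w :
  (Ncount A k t w)%:R * (muhat A Y k t w - mu) =
  Ssum A Y k t w - (Ncount A k t w)%:R * mu.
Proof.
rewrite /muhat mulrBr; congr (_ - _).
(* If arm [k] was never pulled, the quotient defaults to 0, and the identity survives because every
   term of [Ssum] is 0. *)
have [N0|N0] := eqVneq (Ncount A k t w) 0%N; last first.
  by rewrite mulrC divfK// pnatr_eq0.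
rewrite N0 mul0r /Ssum big_nat_cond big1// => s /andP[st _].
move/eqP: N0; rewrite /Ncount sum_nat_seq_eq0 => /allP /(_ s).
by rewrite mem_index_iota st => /(_ isT)/=; case: (A s w == k).
Qed.

Lemma Lproc_exp (mu l c : R) t w :
  Lproc A Y k (fun y => expR (l * (y - mu) - c)) t w =
  expR ((Ncount A k t w)%:R * (l * (muhat A Y k t w - mu) - c)).
Proof.
rewrite mulrBr mulrCA muhat_Ssum /Lproc /Ssum /Ncount natr_sum.
elim: t => [|t IHt]; first by rewrite !big_geq// !(mul0r, mulr0, subr0) expR0.
rewrite !(@big_nat_recr _ _ _ t.+1)//= IHt; case: ifP => _; rewrite ?mulr1 ?addr0//.
by rewrite -expRD; congr expR; rewrite (_ : true%:R = 1 :> R)//; ring.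
Qed.

Hypotheses (psiP : CGF_like psi lmin lmax) (subP : sub_psi psi lmin lmax (Pk k)).
Let mu := mean (Pk k).
Let n w : R := (at_time 0%N (Ncount A k) T w)%:R.
Let X w : R := at_time 0 (muhat A Y k) T w - mu.

Lemma measurable_stopped_count : measurable_fun setT n.
Proof.
rewrite (_ : n = at_time 0 (fun t w => (Ncount A k t w)%:R) T).
  by apply: measurable_stopped; exact: measurable_Ncount.
by apply/funext => w; rewrite /n /at_time; case: (T w).
Qed.

Lemma measurable_stopped_dev : measurable_fun setT X.
Proof.
by apply: measurable_funB => //; apply: measurable_stopped; exact: measurable_muhat.
Qed.

(** The tilt [phi] has mean at most 1 under [Pk k] by the sub-[psi] hypothesis, so optional stopping
    applies to its likelihood process. *)
Lemma stopped_exp_le1 l : (lmin < l%:E < lmax)%E ->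
  (\int[P]_w (expR (n w * (l * X w - psi l)))%:E <= 1)%E.
Proof.
move=> Ll; pose phi y := expR (l * (y - mu) - psi l).
have mexp : measurable_fun [set: R] (fun y => expR (l * (y - mu))).
  apply: measurableT_comp => //; apply: measurable_funM => //.
  exact: measurable_funB.
have mphi : measurable_fun [set: R] phi.
  apply: measurableT_comp => //; apply: measurable_funB => //.
  by apply: measurable_funM => //; exact: measurable_funB.
have phi1 : (\int[Pk k]_y (phi y)%:E <= 1)%E.
  rewrite /phi; under eq_integral do rewrite expRD expRN mulrC EFinM.
  rewrite ge0_integralZl//; last first.
    exact/measurable_EFinP.
  have [_ /(_ l Ll) le] := subP.
  apply: (@le_trans _ _ ((expR (psi l))^-1%:E * (expR (psi l))%:E)%E).
    by apply: lee_wpmul2l => //; rewrite lee_fin invr_ge0 expR_ge0.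
  by rewrite -EFinM mulVf// gt_eqF ?expR_gt0.
(* The default value 1 agrees with [expR 0], since [n] is 0 where [T = None]. *)
have := @optional_stopping _ _ _ _ _ _ _ _ _ _ _ model k phi mphi
  (fun _ => expR_ge0 _) phi1 T stopT 1 ler01.
congr (_ <= _)%E; apply: eq_integral => w _; congr EFin.
rewrite /n /X /at_time; case: (T w) => [t|]; last by rewrite mul0r expR0.
by rewrite Lproc_exp.
Qed.

Lemma measurable_stopped_psi_star :
  measurable_fun setT (fun w => psi_star psi lmin lmax mu (X w + mu)).
Proof.
apply: (measurableT_comp (measurable_psi_star _ _ _ _)).
by apply: measurable_funD => //; exact: measurable_stopped_dev.
Qed.

Lemma measurable_bregman_superlevel x :
  measurable [set w | (x%:E < psi_star psi lmin lmax mu (X w + mu))%E].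
Proof.
rewrite -[X in measurable X]setTI.
by apply: emeasurable_fun_o_infty => //; exact: measurable_stopped_psi_star.
Qed.

(** The factor 2 counts the two signs of the slope: positive slopes are handled by
    [integral_crossing_le1] for [X], negative ones by the same lemma after reflecting both [X] and
    [psi]. *)
Lemma stopped_bregman_tail x : 0 <= x ->
  (\int[P]_(w in [set w | x%:E < psi_star psi lmin lmax mu (X w + mu)])
     (expR (x * n w))%:E <= 2%:E)%E.
Proof.
move=> x0.
have mX := measurable_stopped_dev; have mn := measurable_stopped_count.
have n0 w : 0 <= n w by [].
pose Lp := [set l : R | (lmin < l%:E < lmax)%E /\ 0 < l].
pose Lm := [set l : R | (lmin < (- l)%:E < lmax)%E /\ 0 < l].
have [||mU1 iU1] := @integral_crossing_le1 _ _ _ P X n Lp psi x mX mn n0 _ x0 _.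
- by move=> l [Ll l0]; split => //; exact: (cgf_ge0 psiP).
- by move=> l [Ll _]; exact: stopped_exp_le1.
have [|||mU2 iU2] := @integral_crossing_le1 _ _ _ P (fun w => - X w) n Lm
    (fun l => psi (- l)) x _ mn n0 _ x0 _.
- exact: measurable_funN.
- by move=> l [Ll l0]; split => //; exact: (cgf_ge0 psiP).
- move=> l [Ll _]; have := stopped_exp_le1 Ll.
  by congr (_ <= _)%E; apply: eq_integral => w _; rewrite mulrN mulNr.
set U1 := mkset _ in mU1 iU1; set U2 := mkset _ in mU2 iU2.
have me D : measurable_fun D (fun w => (expR (x * n w))%:E).
  apply/measurable_funTS/measurable_EFinP/measurableT_comp => //.
  exact: measurable_funM.
apply: (@le_trans _ _ (\int[P]_(w in U1 `|` (U2 `\` U1)) (expR (x * n w))%:E)%E).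
  apply: ge0_subset_integral => //.
  - exact: measurable_bregman_superlevel.
  - by apply: measurableU => //; exact: measurableD.
  move=> w /= /(lt_psi_star _)[l Ll]; rewrite addrK => xl.
  have [U1w|U1w] := pselect (U1 w); first by left.
  right; split => //; have [l0|l0|l0] := ltgtP l 0.
  - exists (- l); last by rewrite opprK mulrNN.
    by split; rewrite ?opprK// oppr_gt0.
  - by case: U1w; exists l.
  (* The zero slope certifies only the value 0, which cannot exceed [x >= 0]. *)
  - by move: xl; rewrite l0 mul0r (cgf_0 psiP) subr0 ltNge x0.
rewrite ge0_integral_setU//; last 2 first.
- exact: measurableD.
- by apply/disj_setPS => w [? []].
rewrite (_ : 2%:E = 1 + 1)%E; last by rewrite -EFinD.
apply: leeD => //; apply: le_trans iU2.
by apply: ge0_subset_integral => //; exact: measurableD.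
Qed.

Variables (t0 : nat) (b : R).
Hypotheses (b0 : 0 < b)
  (Tt0 : {ae P, forall w, forall t, T w = Some t -> (t0 <= t)%N})
  (Nb : {ae P, forall w, b <= (Ncount A k t0 w)%:R}).

Lemma stopped_count_ge : {ae P, forall w, b <= n w}.
Proof.
have Tsome : {ae P, forall w, T w <> None}.
  exists [set w | T w = None]; split.
  - apply: measurable_stop_none => t; apply: (filt_measurable model).
    by have [] := stopT; exact.
  - by case: stopT.
  - by move=> w /= /contrapT.
apply: filterS3 Tsome Tt0 Nb => w; rewrite /n /at_time.
case: (T w) => [t _ /(_ t erefl) t0t|//] bN.
by apply: le_trans bN _; rewrite ler_nat Ncount_mono.
Qed.

(** The infinite event lies in every superlevel set, so [(1 + x * b) * P Z <= 2] for all [x >= 0],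
    which fails for large [x] unless [P Z] is 0. *)
Lemma stopped_psi_star_finite :
  P [set w | psi_star psi lmin lmax mu (X w + mu) = +oo%E] = 0%E.
Proof.
set Z := mkset _; have mn := measurable_stopped_count.
have mZ : measurable Z.
  rewrite -[X in measurable X]setTI.
  exact: (measurable_stopped_psi_star measurableT (emeasurable_set1 +oo%E)).
apply/eqP; rewrite eq_le measure_ge0 andbT leNgt; apply/negP => PZ.
have PZf : P Z \is a fin_num by exact: fin_num_measure.
move: PZ; rewrite -(fineK PZf) lte_fin; set p := fine _ => p0.
(* This level makes [(1 + x * b) * p] equal to [p + 2], contradicting the bound 2. *)
pose x := 2 / (p * b); have x0 : 0 <= x by rewrite divr_ge0// mulr_ge0// ltW.
have : ((1 + x * b)%:E * P Z <= 2%:E)%E.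
  apply: le_trans (stopped_bregman_tail x0); rewrite -integral_cst//.
  apply: (@le_trans _ _ (\int[P]_(w in Z) (expR (x * n w))%:E)%E).
    apply: ae_ge0_le_integral => //.
    - by move=> w _; rewrite lee_fin addr_ge0// mulr_ge0// ltW.
    - apply/measurable_funTS/measurable_EFinP/measurableT_comp => //.
      exact: measurable_funM.
    - apply: filterS stopped_count_ge => w bn _; rewrite lee_fin.
      by apply: le_trans (expR_ge1Dx _); rewrite lerD2l ler_wpM2l.
  apply: ge0_subset_integral => //.
  - exact: measurable_bregman_superlevel.
  - apply/measurable_funTS/measurable_EFinP/measurableT_comp => //.
    exact: measurable_funM.
  - by move=> w /= ->; rewrite ltry.
rewrite -(fineK PZf) -EFinM lee_fin -/p.
have -> : (1 + x * b) * p = p + 2 by rewrite /x; field; rewrite !gt_eqF.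
by rewrite gerDr leNgt p0.
Qed.

(** Real-valued divergence: [fine] sends [+oo] to 0, which alters it only on the null event of
    [stopped_psi_star_finite]. *)
Let f w : R := fine (psi_star psi lmin lmax mu (X w + mu)).

Lemma integral_stopped_bregman :
  (\int[P]_w bregman psi lmin lmax mu (at_time 0%R (muhat A Y k) T w) =
   \int[P]_w (f w)%:E)%E.
Proof.
have mpsi := measurable_stopped_psi_star.
pose Z := [set w | psi_star psi lmin lmax mu (X w + mu) = +oo%E].
have mZ : measurable Z.
  rewrite -[X in measurable X]setTI.
  exact: (mpsi measurableT _ (emeasurable_set1 +oo%E)).
under eq_integral do rewrite (bregmanE _ psiP) -[X in psi_star _ _ _ _ X](subrK mu).
have mf : measurable_fun setT (fun w => (f w)%:E).
  by apply/measurable_EFinP; exact: measurableT_comp.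
rewrite (@ge0_negligible_integral _ _ _ _ _ Z)//; last 2 first.
- by move=> w _; exact: (psi_star_ge0 _ psiP).
- exact: stopped_psi_star_finite.
rewrite [RHS](@ge0_negligible_integral _ _ _ _ _ Z)//; last 2 first.
- by move=> w _; rewrite lee_fin fine_ge0// (psi_star_ge0 _ psiP).
- exact: stopped_psi_star_finite.
apply: eq_integral => w; rewrite inE => -[_ wZ]; rewrite /f fineK//.
rewrite ge0_fin_numE ?(psi_star_ge0 _ psiP)// ltey; exact/eqP.
Qed.

Lemma stopped_tail x : 0 <= x ->
  (\int[P]_(w in [set w | (x < f w)%R]) (expR (x * n w))%:E <= 2%:E)%E.
Proof.
move=> x0; apply: le_trans (stopped_bregman_tail x0).
have mn := measurable_stopped_count.
apply: ge0_subset_integral => //.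
- apply: measurable_superlevel; apply: measurableT_comp => //.
  exact: measurable_stopped_psi_star.
- exact: measurable_bregman_superlevel.
- apply/measurable_funTS/measurable_EFinP/measurableT_comp => //.
  exact: measurable_funM.
move=> w /=; rewrite /f; case: (psi_star _ _ _ _ _) => [v|_|]//=.
- by rewrite ltry.
- by rewrite ltNge x0.
Qed.

End StoppedBandit.

(** * The constant [Cr] and the theorem *)

Section Constant.
Context {R : realType}.

Lemma Cr_set_nonempty (r : R) : 1 < r ->
  nonempty [set (2 `^ (q / r) / expR 1 * (r ^+ 2 / ((r - q) * (q - 1))))
           | q in `]1, r[%classic].
Proof.
move=> r1; pose q := (1 + r) / 2.
exists (2 `^ (q / r) / expR 1 * (r ^+ 2 / ((r - q) * (q - 1)))); exists q => //=.
by rewrite in_itv/= /q; apply/andP; split; lra.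
Qed.

(** AM-GM bounds [(r - q) * (q - 1)] by [(r - 1) ^+ 2 / 4], while [r ^+ 2] and the power of 2 are at
    least 1. *)
Lemma Cr_ge (r : R) : 1 < r -> 4 / (expR 1 * (r - 1) ^+ 2) <= Cr r.
Proof.
move=> r1; apply: lb_le_inf; first exact: Cr_set_nonempty.
move=> y [q /=]; rewrite in_itv/= => /andP[q1 qr] <-.
have p0 : 0 < (r - q) * (q - 1) by rewrite mulr_gt0// subr_gt0.
have e0 : 0 < expR 1 :> R by exact: expR_gt0.
have pow1 : 1 <= 2 `^ (q / r) :> R.
  rewrite -[X in X <= _](powRr0 2) ler_powR ?ler1n//.
  by rewrite divr_ge0//; lra.
have s0 : 0 < (r - 1) ^+ 2 by rewrite exprn_gt0// subr_gt0.
have frac : 4 / (r - 1) ^+ 2 <= r ^+ 2 / ((r - q) * (q - 1)).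
  rewrite ler_pdivrMr// mulrAC ler_pdivlMr//.
  apply: (@le_trans _ _ ((r - 1) ^+ 2)).
    (* This square is the difference between [(r - 1) ^+ 2] and [4 * ((r - q) * (q - 1))]. *)
    by have := sqr_ge0 (r - 2 * q + 1); lra.
  by apply: ler_peMl; [exact: sqr_ge0|apply: exprn_ege1; exact: ltW].
rewrite invfM mulrCA; apply: ler_pM => //.
- by rewrite divr_ge0// ltW.
- by rewrite ler_peMl// invr_ge0 ltW.
Qed.

Lemma Cr_cvgy : (@Cr R r) @[r --> (1 : R)^'+] --> +oo.
Proof.
apply/cvgryPge => a.
pose c := 4 / expR 1 : R; have c0 : 0 < c by rewrite divr_gt0// expR_gt0.
pose m := `|a| + 1; have m0 : 0 < m by rewrite ltr_wpDl.
near=> r.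
have r1 : 1 < r by near: r; exact: nbhs_right_gt.
have r2 : r < 2 by near: r; apply: nbhs_right_lt; rewrite ltr1n.
(* For [r < 2] one has [(r - 1) ^+ 2 <= r - 1], so this closeness already gives
   [c / (r - 1) ^+ 2 >= m]. *)
have rc : r < 1 + c / m by near: r; apply: nbhs_right_lt; rewrite ltrDl divr_gt0.
apply: le_trans (Cr_ge r1).
have s0 : 0 < r - 1 by rewrite subr_gt0.
apply: (@le_trans _ _ m); first by rewrite /m; have := ler_norm a; lra.
rewrite invfM mulrA -/c ler_pdivlMr ?exprn_gt0//.
have : (r - 1) * m <= c by rewrite -ler_pdivlMr//; lra.
have : m * (r - 1) ^+ 2 <= (r - 1) * m.
  by rewrite expr2 mulrCA ler_pM2l// ler_piMr ?ltW//; lra.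
lra.
Unshelve. all: by end_near.
Qed.

End Constant.

Theorem theorem2 (R : realType) (d dW : measure_display)
  (Omega : measurableType d) (P : probability Omega R)
  (TW : measurableType dW) (K : nat) (Pk : 'I_K -> probability R R)
  (W : Omega -> TW) (A : nat -> Omega -> 'I_K) (Y : nat -> Omega -> R)
  (T : Omega -> option nat)
  (psi : R -> R) (lmin lmax : \bar R) (k : 'I_K) (t0 : nat) (b : R) :
  (forall a, (Pk a).-integrable setT (fun x => x%:E)) ->
  bandit_model P Pk W A Y ->
  as_finite_stopping_time P W A Y T ->
  CGF_like psi lmin lmax ->
  sub_psi psi lmin lmax (Pk k) ->
  0 < b ->
  {ae P, forall w, forall t, T w = Some t -> (t0 <= t)%N} ->
  {ae P, forall w, b <= (Ncount A k t0 w)%:R} ->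
  let N := at_time 0%N (Ncount A k) T in
  let mu := mean (Pk k) in
  (\int[P]_w bregman psi lmin lmax mu (at_time 0%R (muhat A Y k) T w)
   <= (Order.min (2 * expR 1 * (1 + ln (n_eff P N / b)) / n_eff P N)
                 (inf [set Cr r / n_eff_r P N r | r in `]1, +oo[%classic]))%:E)%E
  /\ (@Cr R r) @[r --> (1 : R)^'+] --> +oo.
Proof.
move=> _ model stopT psiP subP b0 Tt0 Nb N mu; split; last exact: Cr_cvgy.
rewrite (integral_stopped_bregman model stopT psiP subP b0 Tt0 Nb).
pose f w : R :=
  fine (psi_star psi lmin lmax mu (at_time 0 (muhat A Y k) T w - mu + mu)).
rewrite -[leLHS]/(\int[P]_w (f w)%:E)%E.
pose n w : R := (N w)%:R.
have mn : measurable_fun setT n by exact: (measurable_stopped_count k model stopT).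
have mf : measurable_fun setT f.
  have mpsi := measurable_stopped_psi_star psi lmin lmax k model stopT.
  exact: measurableT_comp mpsi.
have n0 w : 0 <= n w by [].
have f0 w : 0 <= f w by apply: fine_ge0; exact: (psi_star_ge0 _ psiP).
have bn : {ae P, forall w, b <= n w} := stopped_count_ge model stopT Tt0 Nb.
have tailP x := @stopped_tail _ _ _ _ _ _ _ _ _ _ _ _ _ _ _ k model stopT
  psiP subP x.
have n_gt0 : {ae P, forall w, 0 < n w}.
  by apply: filterS bn => w; exact: lt_le_trans.
pose v := fine (\int[P]_w ((n w)^-1)%:E).
have mV := measurable_inv_weight mn n0.
have Vfin := fin_num_inv_weight mn n0 b0 bn.
have v0 : 0 < v.
  rewrite fine_gt0// ltey_eq Vfin andbT; apply: integral_gt0 => //.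
  - by move=> w; rewrite invr_ge0.
  - by apply: filterS n_gt0 => w nw; rewrite invr_gt0.
rewrite EFin_min le_min; apply/andP; split.
  apply: le_trans (anytime_risk_log mf mn f0 n0 b0 bn tailP v0) _.
  rewrite -/v /n_eff -/v lee_fin invrK.
  have vb : v <= b^-1.
    by rewrite -lee_fin fineK//; exact: integral_inv_weight_le.
  have L0 : 0 <= ln (v^-1 / b).
    by rewrite ln_ge0// ler_pdivlMr// mul1r -[b]invrK lef_pV2 ?posrE ?invr_gt0.
  (* With [L] the logarithm, nonnegative by [L0], [2 + L <= 2 * (1 + L) <= expR 1 * (1 + L)]
     converts the bound to the stated constant. *)
  have e2 : 2 <= expR 1 :> R by have := expR_ge1Dx (1 : R); lra.
  rewrite [X in _ <= X]mulrC -[2 * v]mulrC -!mulrA ler_pM2l// ler_pM2l//.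
  have : 2 * (1 + ln (v^-1 / b)) <= expR 1 * (1 + ln (v^-1 / b)).
    by rewrite ler_wpM2r// addr_ge0.
  lra.
(* The infimum is over reals, so the expectation must be real before it can serve as a lower bound;
   the logarithmic estimate supplies finiteness. *)
have If : (\int[P]_w (f w)%:E)%E \is a fin_num.
  rewrite ge0_fin_numE; last by apply: integral_ge0 => w _; rewrite lee_fin.
  exact: le_lt_trans (anytime_risk_log mf mn f0 n0 b0 bn tailP v0) (ltry _).
rewrite -(fineK If) lee_fin; apply: lb_le_inf.
  by exists (Cr 2 / n_eff_r P N 2); exists 2 => //=; rewrite in_itv/= ltr1n.
move=> y [r /=]; rewrite in_itv/= andbT => r1 <-.
pose M := fine (\int[P]_w (((n w) `^ r)^-1)%:E).
have M0 : 0 < M.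
  have Mfin := fin_num_inv_weight_pow mn b0 bn r1.
  rewrite fine_gt0// ltey_eq Mfin andbT; apply: integral_gt0 => //.
  - exact: measurable_inv_weight_pow.
  - by move=> w; rewrite invr_ge0 powR_ge0.
  - by apply: filterS n_gt0 => w nw; rewrite invr_gt0 powR_gt0.
(* The reciprocal of [n_eff_r] is [M ^ (1 / r)]; dividing by it isolates [Cr r], whose infimum is
   then tested at each [q]. *)
rewrite /n_eff_r -/M powRN invrK -ler_pdivrMr ?powR_gt0//.
apply: lb_le_inf; first exact: Cr_set_nonempty.
move=> z [q /=]; rewrite in_itv/= => q1r <-.
rewrite ler_pdivrMr ?powR_gt0// -lee_fin fineK//.
exact: (anytime_risk_pow mf mn f0 b0 bn tailP r1 M0 q1r).
Qed.
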